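(* Let $d\ge 3$ be a fixed integer. For every sufficiently small constant $\alpha>0$ there is a constant $A=A(\alpha,d)$ such that the following holds for all sufficiently large primes $p$. If $\mathbf{s}\in\mathbb{R}^p/2\pi\mathbb{Z}^p$ satisfies $$|\phi_{X-\boldsymbol\mu}(\mathbf{s})|\ge 1-\alpha p^{-2},$$ then there exists $j\in\{0,\dots,p-1\}$ such that $\mathbf{s}\in B_j(\kappa)$ (modulo $2\pi\mathbb{Z}^p$) for some $\kappa\le A p^{-1}$.
   Context: For $\mathbf{x}=(x_1,\dots,x_d)\in\mathbb{F}_p^d$ let $\Phi(\mathbf{x})=(m_0,\dots,m_{p-1})\in\mathbb{Z}_{\ge0}^p$, where $m_j$ is the number of coordinates of $\mathbf{x}$ equal to $j$ (elements of $\mathbb{F}_p$ identified with $\{0,\dots,p-1\}$). Let $\mathcal{U}_{d,p}$ be the multiset $\{\Phi(\mathbf{x}):\mathbf{x}\in\mathbb{F}_p^d,\ \sum_{i=1}^d x_i=0\}$, and let $X$ be uniformly distributed over this multiset, with mean $\boldsymbol\mu=\mathbb{E}X=(d/p,\dots,d/p)$. The characteristic function is $\phi_{X-\boldsymbol\mu}(\mathbf{s})=\mathbb{E}\exp(i\,\mathbf{s}\cdot(X-\boldsymbol\mu))$ for $\mathbf{s}\in\mathbb{R}^p$; its modulus equals $\left|\frac{1}{p^{d-1}}\sum_{\mathbf{w}\in\mathcal{U}_{d,p}}e^{i\mathbf{s}\cdot\mathbf{w}}\right|$ and is $2\pi\mathbb{Z}^p$-periodic. For $\kappa>0$ and $j=0,\dots,p-1$,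 $$B_j(\kappa)=2\pi j\,(0,1/p,\dots,(p-1)/p)+Q\big(\{\mathbf{x}\in\mathbb{R}^{p-1}:\|\mathbf{x}\|_2^2\le\kappa\}\times[0,2\sqrt p\,\pi]\big),$$ where $Q=[O,\mathbf{1}/\sqrt p]$ is a $p\times p$ orthogonal matrix whose last column is $\mathbf{1}/\sqrt p$, with $\mathbf 1=(1,\dots,1)^t$, and whose first $p-1$ columns (forming $O$) are an orthonormal basis of $\mathbf{1}^\perp$. *)

(* Defs.v *)
From HB Require Import structures.
From mathcomp Require Import all_boot all_order all_algebra.
From mathcomp Require Import complex.
From mathcomp Require Import all_classical all_reals all_analysis.

Set Implicit Arguments.
Unset Strict Implicit.
Unset Printing Implicit Defensive.

Import Order.TTheory GRing.Theory Num.Theory.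

Local Open Scope classical_set_scope.
Local Open Scope ring_scope.
Local Open Scope complex_scope.

Section Multiset.
Variables d p : nat.

(* For prime [p], the elements of ['F_p] are the ordinals 0, ..., p-1, so they
   are compared with the index [j : 'I_p] through their values in [nat]. *)
Definition Phi (x : 'rV['F_p]_d) : 'cV[nat]_p :=
  \col_(j < p) #|[pred i : 'I_d | x 0 i == j :> nat]|.

(* A multiset is represented by a sequence, repetitions included: each zero-sum
   [x] contributes one occurrence of [Phi x]. *)
Definition Umset : seq 'cV[nat]_p :=
  [seq Phi x | x in [pred x : 'rV['F_p]_d | \sum_i x 0 i == 0]].

End Multiset.

(* E f(X) for X uniformly distributed over the multiset [U]. *)
Definition unif_mean (T : Type) (K : fieldType) (U : seq T) (f : T -> K) : K :=
  (\sum_(w <- U) f w) / (size U)%:R.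

Section CharacteristicFunction.
Variables (R : realType) (d p : nat).

Definition mu : 'cV[R]_p :=
  \col_j unif_mean (Umset d p) (fun w => (w j 0)%:R).

Definition dotv (s w : 'cV[R]_p) : R := \sum_j s j 0 * w j 0.

Definition expi (t : R) : R[i] := cos t +i* sin t.

Definition charfun (s : 'cV[R]_p) : R[i] :=
  unif_mean (Umset d p)
    (fun w => expi (dotv s (map_mx (fun n : nat => n%:R) w - mu))).

End CharacteristicFunction.

Section Tubes.
Variables (R : realType) (p : nat).

(* The number of columns of [Qmx O] is [p.-1 + 1], which equals [p] for [0 < p]
   but not by conversion. *)
Definition Qmx (O : 'M[R]_(p, p.-1)) : 'M[R]_(p, p.-1 + 1) :=
  row_mx O (const_mx (Num.sqrt p%:R)^-1).

(* Orthogonality of [Qmx O]; since its last column is 1/sqrt p, this says that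
   the columns of [O] form an orthonormal basis of the complement of 1. *)
Definition orthogonalQ (O : 'M[R]_(p, p.-1)) : Prop :=
  (Qmx O)^T *m Qmx O = 1%:M /\ Qmx O *m (Qmx O)^T = 1%:M.

Definition Bset (O : 'M[R]_(p, p.-1)) (j : 'I_p) (kappa : R) : set 'cV[R]_p :=
  [set (2 * pi * j%:R) *: (\col_(i < p) (i%:R / p%:R)) + Qmx O *m col_mx x t%:M
    | x in [set x : 'cV[R]_p.-1 | \sum_i x i 0 ^+ 2 <= kappa]
    & t in `[0, 2 * Num.sqrt p%:R * pi]].

Definition in_mod_2piZ (s : 'cV[R]_p) (S : set 'cV[R]_p) : Prop :=
  exists k : 'cV[int]_p, S (s + (2 * pi) *: map_mx intr k).

End Tubes.

(* Main.v *)
(* Writing [f a = exp(i s_a)] and [F] for its Fourier transform on ['F_p], the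
   count over zero-sum vectors gives [phi = sum_xi (F xi / p)^d] up to a unimodular
   factor. By Parseval [sum_xi |F xi / p|^2 = 1], so as [d >= 3] some [xi] has
   [|F xi| / p >= |phi| >= 1 - alpha / p^2]. Rotating [F xi] to the positive reals
   and taking real parts, the phases [s_a - 2 pi xi a / p - theta], reduced to
   [[-pi, pi]], have [sum_a (1 - cos) <= alpha / p]; since [1 - cos t >= t^2 / 8]
   there, the sum of their squares is at most [8 alpha / p]. This bounds the
   component of [s - 2 pi xi a / p] orthogonal to 1, while the component along 1
   only matters modulo [2 pi sqrt p]. *)

Require Import Defs.
From mathcomp Require Import all_boot all_order all_algebra.
From mathcomp Require Import complex.
From mathcomp Require Import all_classical all_reals all_analysis.
From mathcomp Require Import ring lra.
Import Order.TTheory GRing.Theory Num.Theory.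
Import numFieldNormedType.Exports.
Local Open Scope ring_scope.
Local Open Scope complex_scope.

(** * A quadratic lower bound for one minus cosine *)

Lemma sin_mul_cos_ge (R : realType) (v : R) :
  0 <= v <= pi / 4 -> v / 2 <= sin v * cos v.
Proof.
move=> /andP[v0 v4]; have pi0 := pi_gt0 R.
have [c|c] := @MVT_segment R sin cos 0 v v0 (fun x _ => is_derive_sin x).
  exact/continuous_subspaceT/continuous_sin.
rewrite in_itv/= sin0 !subr0 => /andP[c0 cv] ->.
have cc : cos v <= cos c.
  have [->//|/negP/negP cNv] := eqVneq c v.
  by apply: ltW; rewrite ltr_cos ?in_itv/= ?lt_neqAle ?cNv //; apply/andP; split; lra.
(* By the double angle formula this gives cos v ^ 2 >= 1/2, while the mean value theorem gave sin v
   = v cos c >= v cos v. *)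
have : 0 <= cos (v *+ 2) by apply: cos_ge0_pihalf; apply/andP; split; lra.
rewrite cos_mulr2n => cv2.
have cv0 : 0 <= cos v by apply: cos_ge0_pihalf; apply/andP; split; lra.
have h1 : 0 <= v * cos v * (cos c - cos v) by rewrite !mulr_ge0 ?subr_ge0.
have h2 : 0 <= v * (cos v ^+ 2 *+ 2 - 1) by rewrite mulr_ge0.
lra.
Qed.

(** By evenness take t >= 0. With t = 4 v, doubling twice gives 1 - cos t = 8 (sin v cos v)^2, and
    [sin_mul_cos_ge] bounds this below by 8 (v / 2)^2 = t^2 / 8. *)
Lemma one_sub_cos_ge (R : realType) (t : R) :
  - pi <= t <= pi -> t ^+ 2 / 8 <= 1 - cos t.
Proof.
wlog t0 : t / 0 <= t => [hw|/andP[_ tpi]].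
  have [/hw//|t0 /andP[t1 t2]] := leP 0 t.
  by rewrite -(cosN t) -sqrrN; apply: hw; [|apply/andP; split]; lra.
have [v tv] : exists v, t = v *+ 2 *+ 2 by exists (t / 4); field.
rewrite tv in t0 tpi *.
have h : v / 2 <= sin v * cos v by apply: sin_mul_cos_ge; apply/andP; split; lra.
have v0 : 0 <= v / 2 by lra.
have {}h : (v / 2) ^+ 2 <= (sin v * cos v) ^+ 2.
  by rewrite ler_pXn2r // nnegrE // (le_trans v0).
rewrite cos_mulr2n cos2sin2 sin_mulr2n.
have -> : (v *+ 2 *+ 2) ^+ 2 / 8 = 8 * (v / 2) ^+ 2 by field.
have -> : 1 - ((1 - (cos v * sin v *+ 2) ^+ 2) *+ 2 - 1) = 8 * (sin v * cos v) ^+ 2 by ring.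
by rewrite ler_pM2l.
Qed.

(** * Unit complex numbers: exponent laws, polar form, reduction of angles *)

Section Expi.
Variable R : realType.
Implicit Types t u : R.

Lemma expiD t u : expi (t + u) = expi t * expi u.
Proof. by rewrite /expi cosD sinD; congr (_ +i* _); rewrite addrC [_ * cos u]mulrC. Qed.

Lemma expi0 : expi (0 : R) = 1.
Proof. by rewrite /expi cos0 sin0. Qed.

Lemma norm_expi t : `|expi t| = 1.
Proof. by rewrite normc_def /= cos2Dsin2 sqrtr1. Qed.

Lemma expi_neq0 t : expi t != 0.
Proof. by rewrite -normr_eq0 norm_expi oner_eq0. Qed.

Lemma expiN t : expi (- t) = (expi t)^-1.
Proof.
by apply: (mulIf (expi_neq0 t)); rewrite mulVf ?expi_neq0 // -expiD addNr expi0.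
Qed.

Lemma conjc_expi t : (expi t)^*%C = expi (- t).
Proof. by rewrite /expi cosN sinN. Qed.

Lemma expi_sum (I : Type) (r : seq I) (P : pred I) (F : I -> R) :
  expi (\sum_(i <- r | P i) F i) = \prod_(i <- r | P i) expi (F i).
Proof. exact: (big_morph _ expiD expi0). Qed.

Lemma expi2pi : expi (2 * pi : R) = 1.
Proof. by rewrite mulr_natl /expi cos2pi sin2pi. Qed.

Lemma expi_mulz t (n : int) : expi (t * n%:~R) = expi t ^ n.
Proof.
have expi_muln m : expi (t * m%:R) = expi t ^+ m.
  elim: m => [|m IH]; first by rewrite mulr0 expi0.
  by rewrite mulrSr mulrDr mulr1 expiD IH exprSr.
case: n => n; first exact: expi_muln.
by rewrite NegzE mulrNz mulrN expiN expi_muln.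
Qed.

Lemma cos_add2piz t (n : int) : cos (t + 2 * pi * n%:~R) = cos t.
Proof.
have : expi (t + 2 * pi * n%:~R) = expi t.
  by rewrite expiD expi_mulz expi2pi exp1rz mulr1.
by case.
Qed.

Lemma polar (z : R[i]) : exists t, z = `|z| * expi t.
Proof.
have [->|z0] := eqVneq z 0; first by exists 0; rewrite normr0 mul0r.
have nz0 : `|z| != 0 by rewrite normr_eq0.
suff [t zt] : exists t, z / `|z| = expi t by exists t; rewrite -zt mulrC divfK.
have: `|z / `|z| | = 1 by rewrite normf_div normr_id divff.
case: (z / `|z|) => a b; rewrite normc_def/= => /complexI ab1.
have {}ab1 : a ^+ 2 + b ^+ 2 = 1.
  by rewrite -[LHS]sqr_sqrtr ?ab1 ?expr1n // addr_ge0 ?sqr_ge0.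
have a1 : -1 <= a <= 1 by apply/andP; split; nra.
have b2 : 1 - a ^+ 2 = b ^+ 2 by rewrite -ab1; ring.
have [b0|b0] := leP 0 b.
  by exists (acos a); rewrite /expi acosK ?in_itv// sin_acos// b2 sqrtr_sqr ger0_norm.
exists (- acos a); rewrite /expi cosN sinN acosK ?in_itv// sin_acos// b2 sqrtr_sqr.
by rewrite ltr0_norm // opprK.
Qed.

Lemma mod2pi t : exists n : int, - pi <= t - 2 * pi * n%:~R <= pi.
Proof.
have pi0 := pi_gt0 R.
exists (Num.floor ((t + pi) / (2 * pi))).
set n := Num.floor _.
have h1 : n%:~R <= (t + pi) / (2 * pi) by apply: ge_floor.
have h2 : (t + pi) / (2 * pi) < (n + 1)%:~R by apply: lt_succ_floor.
rewrite ler_pdivlMr in h1; last by lra.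
rewrite ltr_pdivrMr in h2; last by lra.
by rewrite intrD in h2; apply/andP; split; lra.
Qed.

End Expi.

(** * Characters and Fourier analysis on ['F_p] *)

Section Fourier.
Variables (R : realType) (p : nat).
Hypothesis p_pr : prime p.
Local Notation C := R[i].

Definition chi (a : 'F_p) : C := expi (2 * pi * (a%:R / p%:R)).

Let p_neq0 : p%:R != 0 :> R.
Proof. by rewrite pnatr_eq0 -lt0n prime_gt0. Qed.

Lemma chi_natr (n : nat) : chi n%:R = expi (2 * pi * (n%:R / p%:R)).
Proof.
rewrite /chi (val_Fp_nat p_pr) [in RHS](divn_eq n p) natrD natrM [X in _ = expi (_ * X)]mulrDl mulfK //.
by rewrite [in RHS]mulrDr expiD (expi_mulz _ _ (n %/ p)%N) expi2pi exp1rz mul1r.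
Qed.

(** Makes the Fourier kernel a phase linear in the representative of [a], which is the shape of the
    base point of a tube [Bset]. *)
Lemma chiM (a b : 'F_p) : chi (a * b) = expi (2 * pi * (b%:R / p%:R) * a%:R).
Proof.
by rewrite -[a in LHS]natr_Zp -[b in LHS]natr_Zp -natrM chi_natr natrM; congr expi; ring.
Qed.

Lemma chiD (a b : 'F_p) : chi (a + b) = chi a * chi b.
Proof.
rewrite -[a in LHS]natr_Zp -[b in LHS]natr_Zp -natrD chi_natr natrD -expiD.
by congr expi; ring.
Qed.

Lemma chi0 : chi 0 = 1.
Proof. by rewrite (chi_natr 0) mul0r mulr0 expi0. Qed.

Lemma norm_chi a : `|chi a| = 1.
Proof. exact: norm_expi. Qed.

Lemma chi_neq0 a : chi a != 0.
Proof. exact: expi_neq0. Qed.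

Lemma chiN (a : 'F_p) : chi (- a) = (chi a)^-1.
Proof. by apply: (mulIf (chi_neq0 a)); rewrite -chiD addNr chi0 mulVf ?chi_neq0. Qed.

Lemma conjc_chi (a : 'F_p) : (chi a)^*%C = chi (- a).
Proof. by rewrite chiN /chi conjc_expi expiN. Qed.

Lemma chi_sum (I : Type) (r : seq I) (P : pred I) (F : I -> 'F_p) :
  chi (\sum_(i <- r | P i) F i) = \prod_(i <- r | P i) chi (F i).
Proof. exact: (big_morph _ chiD chi0). Qed.

(** If [a] were nonzero, 1 would be a natural multiple of it, so [chi 1 = 1]; but 2 pi / p lies in
    ]0, pi], where cosine is never 1. *)
Lemma chi_eq1 (a : 'F_p) : chi a = 1 -> a = 0.
Proof.
move=> chia; apply/eqP; apply: contraT => a0.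
have : chi 1 = 1.
  rewrite -(mulfV a0) -[a^-1]natr_Zp; elim: (a^-1 : nat) => [|n IH].
    by rewrite mulr0 chi0.
  by rewrite mulrSr mulrDr mulr1 chiD IH chia mulr1.
rewrite (chi_natr 1) mulrA mulr1 => -[cos1 _].
have p2 : 2 <= p%:R :> R by rewrite ler_nat prime_gt1.
have pi0 := pi_gt0 R; have p0 : 0 < p%:R :> R by lra.
have : 2 * pi / p%:R = 0 :> R.
  have h0 : 0 <= 2 * pi / p%:R :> R by rewrite divr_ge0 //; lra.
  have hpi : 2 * pi / p%:R <= pi :> R by rewrite ler_pdivrMr //; nra.
  by apply: cos_inj; rewrite ?cos0 // in_itv /= ?h0 ?lexx ?(ltW pi0).
by move/eqP; rewrite gt_eqF // divr_gt0 //; lra.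
Qed.

Lemma sum_chi (a : 'F_p) : \sum_xi chi (a * xi) = if a == 0 then p%:R else 0.
Proof.
case: eqP => [->|a0].
  under eq_bigr do rewrite mul0r chi0.
  by rewrite sumr_const card_Fp.
apply/eqP; have : (chi a - 1) * \sum_xi chi (a * xi) = 0.
  (* Translating [xi] by 1 permutes the terms and multiplies the sum by [chi a]. *)
  rewrite mulrBl mul1r mulr_sumr [X in _ - X](reindex_inj (addrI 1)) /=.
  by rewrite -sumrB big1 // => xi _; rewrite mulrDr mulr1 chiD subrr.
by move/eqP; rewrite mulf_eq0 subr_eq0 => /orP[/eqP/chi_eq1|].
Qed.

Definition fourier (f : 'F_p -> C) (xi : 'F_p) : C := \sum_a f a * chi (- (a * xi)).

(** Expanding the power gives a sum over all vectors [x]; summing over [xi] first, orthogonality of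
    characters keeps the zero-sum [x], each with weight p. *)
Lemma sum_fourier_exp d (f : 'F_p -> C) :
  \sum_xi fourier f xi ^+ d =
  p%:R * \sum_(x : 'rV['F_p]_d | \sum_i x 0 i == 0) \prod_i f (x 0 i).
Proof.
have expand xi : fourier f xi ^+ d =
    \sum_(x : 'rV['F_p]_d) (\prod_i f (x 0 i)) * chi (- (\sum_i x 0 i) * xi).
  rewrite -[d in LHS]card_ord -prodr_const bigA_distr_bigA /=.
  rewrite (reindex (fun x : 'rV['F_p]_d => [ffun i => x 0 i])) /=; last first.
    exists (fun h : {ffun 'I_d -> 'F_p} => \row_i h i) => [x|h] _.
      by apply/rowP => i; rewrite mxE ffunE.
    by apply/ffunP => i; rewrite ffunE mxE.
  apply: eq_bigr => x _; rewrite mulNr mulr_suml -sumrN chi_sum -big_split /=.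
  by apply: eq_bigr => i _; rewrite ffunE.
under eq_bigr do rewrite expand.
rewrite exchange_big /= [in RHS]big_mkcond mulr_sumr; apply: eq_bigr => x _.
rewrite -mulr_sumr sum_chi oppr_eq0.
by case: ifP => _; rewrite ?mulr0 // mulrC.
Qed.

Lemma parseval (f : 'F_p -> C) :
  \sum_xi `|fourier f xi| ^+ 2 = p%:R * \sum_a `|f a| ^+ 2.
Proof.
have expand xi : `|fourier f xi| ^+ 2 =
    \sum_a \sum_b f a * (f b)^*%C * chi ((b - a) * xi).
  rewrite sqr_normc /fourier rmorph_sum big_distrlr /=.
  apply: eq_bigr => a _; apply: eq_bigr => b _.
  by rewrite rmorphM [X in _ * (_ * X)]conjc_chi opprK mulrBl chiD; ring.
under eq_bigr do rewrite expand.
rewrite exchange_big mulr_sumr; apply: eq_bigr => a _.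
rewrite exchange_big (bigD1 a) //= [X in _ + X]big1 ?addr0 => [|b ba].
  by rewrite -mulr_sumr sum_chi subrr eqxx sqr_normc mulrC.
by rewrite -mulr_sumr sum_chi subr_eq0 (negbTE ba) mulr0.
Qed.

Lemma fourier1 xi : fourier (fun=> 1) xi = if xi == 0 then p%:R else 0.
Proof.
by rewrite -oppr_eq0 -sum_chi; apply: eq_bigr => a _; rewrite mul1r mulNr mulrC.
Qed.

(** This is [sum_fourier_exp] for the constant 1, whose transform is p at 0 and vanishes
    elsewhere. *)
Lemma card_zero_sum d : (0 < d)%N ->
  p%:R * #|[pred x : 'rV['F_p]_d | \sum_i x 0 i == 0]|%:R = p%:R ^+ d :> C.
Proof.
move=> d0; have -> : #|[pred x : 'rV['F_p]_d | \sum_i x 0 i == 0]|%:R =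
    \sum_(x : 'rV['F_p]_d | \sum_i x 0 i == 0) \prod_(i < d) 1 :> C.
  by rewrite -sumr_const; apply: eq_bigr => x _; rewrite big1.
rewrite -(sum_fourier_exp d (fun=> 1)) (bigD1 0) //= fourier1 eqxx big1 ?addr0 // => xi xi0.
by rewrite fourier1 (negbTE xi0) expr0n eqn0Ngt d0.
Qed.

(* For [d >= 3], [|\sum_xi F xi ^+ d| <= max |F| ^+ (d - 2) * \sum_xi |F xi| ^+ 2]. *)
Lemma ex_large_fourier d (f : 'F_p -> C) : (3 <= d)%N -> (forall a, `|f a| = 1) ->
  exists xi, p%:R * `|\sum_(x : 'rV['F_p]_d | \sum_i x 0 i == 0) \prod_i f (x 0 i)|
    <= p%:R ^+ d.-1 * `|fourier f xi|.
Proof.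
(* The order on [R[i]] is only partial, so the maximum is taken over real-valued moduli. *)
move=> d3 f1; pose F xi := complex.Re `|fourier f xi|.
have FE xi : `|fourier f xi| = (F xi)%:C by rewrite RRe_real ?normr_real.
have F0 xi : 0 <= F xi by rewrite -ler0c -FE.
exists [arg max_(xi > 0 | true) F xi]%O; case: arg_maxP => // xi _ Fmax.
have Fp : F xi <= p%:R.
  rewrite -lecR -FE rmorph_nat; apply: le_trans (ler_norm_sum _ _ _) _.
  by under eq_bigr do rewrite normrM f1 norm_chi mulr1; rewrite sumr_const card_Fp.
have -> : p%:R = `|p%:R| :> C by rewrite normr_nat.
rewrite -normrM -sum_fourier_exp normr_nat.
apply: le_trans (ler_norm_sum _ _ _) _.
have : \sum_eta F eta ^+ 2 = p%:R ^+ 2.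
  apply: (@complexI R); rewrite rmorph_sum rmorphXn rmorph_nat /=.
  under eq_bigr do rewrite rmorphXn /= -FE.
  rewrite parseval; under eq_bigr do rewrite f1 expr1n.
  by rewrite sumr_const card_Fp.
have -> : p%:R ^+ d.-1 * `|fourier f xi| = (p%:R ^+ d.-1 * F xi)%:C.
  by rewrite FE rmorphM rmorphXn /= rmorph_nat.
have -> : \sum_eta `|fourier f eta ^+ d| = (\sum_eta F eta ^+ d)%:C.
  by rewrite rmorph_sum; apply: eq_bigr => eta _; rewrite normrX FE rmorphXn.
rewrite lecR => P.
case: d d3 => [|[|[|d]]] // _.
apply: (@le_trans _ _ (\sum_eta F eta ^+ 2 * F xi ^+ d.+1)).
  apply: ler_sum => eta _; rewrite -[d.+3]/(2 + d.+1)%N exprD ler_wpM2l ?exprn_ge0 //.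
  by rewrite ler_pXn2r ?nnegrE ?F0 //; exact: Fmax.
(* Parseval accounts for p^2; of the remaining factors [F xi], one is kept and the others are
   bounded by p. *)
rewrite -mulr_suml P -[d.+3.-1]/(2 + d)%N exprD -mulrA ler_wpM2l ?exprn_ge0 //.
by rewrite exprSr ler_wpM2r // lerXn2r ?nnegrE.
Qed.

End Fourier.

(** * Coordinates in the orthonormal basis [Qmx O] *)

Section Orthogonal.
Variables (R : realType) (p : nat).
Variable O : 'M[R]_(p, p.-1).
Hypothesis p_gt0 : (0 < p)%N.
Hypothesis O_orth : orthogonalQ O.

Lemma sqnormE n (v : 'cV[R]_n) : (v^T *m v) 0 0 = \sum_i v i 0 ^+ 2.
Proof. by rewrite mxE; apply: eq_bigr => i _; rewrite mxE expr2. Qed.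

(** Read off from an off-diagonal block of Q^T Q = 1. *)
Lemma trO_const (c : R) : O^T *m const_mx c = 0 :> 'cV_(p.-1).
Proof.
have [+ _] := O_orth.
rewrite /Qmx tr_row_mx mul_col_row scalar_mx_block.
move/eq_block_mx => [_ + _ _].
set r := _^-1 => Or.
have r0 : r != 0 by rewrite invr_eq0 sqrtr_eq0 -ltNge ltr0n.
have -> : const_mx c = (c / r) *: const_mx r :> 'cV_p.
  by apply/matrixP => i j; rewrite !mxE divfK.
by rewrite -scalemxAr Or scaler0.
Qed.

(** Take x = O^T v: constants are killed by O^T, and x is part of Q^T v, which has the norm of v.
    The last coordinate is sqrt p times the mean of the entries. *)
Lemma Qmx_decomp (c : R) (v : 'cV[R]_p) :
  exists2 x : 'cV[R]_p.-1, \sum_i x i 0 ^+ 2 <= \sum_i v i 0 ^+ 2 &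
    const_mx c + v = Qmx O *m col_mx x (Num.sqrt p%:R * (c + (\sum_i v i 0) / p%:R))%:M.
Proof.
have [_ QQ] := O_orth; have p0 : 0 < p%:R :> R by rewrite ltr0n.
set r := Num.sqrt p%:R.
have r0 : r != 0 by rewrite sqrtr_eq0 -ltNge.
have rr : r ^+ 2 = p%:R by rewrite sqr_sqrtr // ltW.
have QtE y : (Qmx O)^T *m y = col_mx (O^T *m y) ((const_mx r^-1)^T *m y) :> 'cV_(_).
  by rewrite /Qmx tr_row_mx mul_col_mx.
exists (O^T *m v); last first.
  rewrite -[LHS]mul1mx -QQ -mulmxA QtE mulmxDr trO_const add0r; congr (_ *m col_mx _ _).
  apply/matrixP => i j; rewrite !ord1 !mxE eqxx mulr1n.
  under eq_bigr do rewrite !mxE.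
  rewrite -mulr_sumr big_split /= sumr_const card_ord -(mulr_natr c) -rr.
  by field.
rewrite -!sqnormE.
have -> : v^T *m v = ((Qmx O)^T *m v)^T *m ((Qmx O)^T *m v).
  by rewrite trmx_mul trmxK mulmxA -[_ *m _ *m _^T]mulmxA QQ mulmx1.
rewrite QtE tr_col_mx mul_row_col [leRHS]mxE lerDl sqnormE.
by apply: sumr_ge0 => i _; exact: sqr_ge0.
Qed.

End Orthogonal.

(** * From the characteristic function to a large cosine sum *)

Section CharacteristicFunction.
Variables (R : realType) (p : nat).
Hypothesis p_pr : prime p.
Implicit Types s w : 'cV[R]_p.

(** ['F_p] and ['I_p] have provably equal but not convertible bounds, hence the cast. *)
Definition ord_of_Fp (a : 'F_p) : 'I_p := cast_ord (Fp_cast p_pr) a.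

Lemma dotv_Phi d s (x : 'rV['F_p]_d) :
  dotv s (map_mx (fun n : nat => n%:R) (Phi x)) = \sum_i s (ord_of_Fp (x 0 i)) 0.
Proof.
pose m j i : R := (x 0 i == j :> nat)%:R.
transitivity (\sum_j \sum_i s j 0 * m j i).
  apply: eq_bigr => j _; rewrite !mxE -sum1_card natr_sum big_mkcond mulr_sumr.
  by apply: eq_bigr => i _; rewrite /m inE; case: eqP.
rewrite exchange_big; apply: eq_bigr => i _.
rewrite (bigD1 (ord_of_Fp (x 0 i))) //= /m eqxx mulr1 big1 ?addr0 // => j ji.
by rewrite -val_eqE /= eq_sym in ji; rewrite (negbTE ji) mulr0.
Qed.

Lemma dotvB s w1 w2 : dotv s (w1 - w2) = dotv s w1 - dotv s w2.
Proof.
by rewrite /dotv -sumrB; apply: eq_bigr => j _; rewrite !mxE mulrBr.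
Qed.

Lemma norm_charfun d s : `|charfun d s| =
  `|\sum_(x : 'rV['F_p]_d | \sum_i x 0 i == 0) \prod_i expi (s (ord_of_Fp (x 0 i)) 0)|
  / #|[pred x : 'rV['F_p]_d | \sum_i x 0 i == 0]|%:R.
Proof.
rewrite /charfun /unif_mean normf_div normr_nat size_image; congr (_ / _).
rewrite big_image /=.
(* Centring at [mu] only contributes a common factor of modulus 1. *)
rewrite -[RHS]mulr1 -[X in _ = _ * X](norm_expi R (- dotv s (mu R d p))) -normrM mulr_suml.
congr `|_|; apply: eq_bigr => x _.
by rewrite dotvB expiD dotv_Phi expi_sum.
Qed.

Lemma charfun_le_fourier d s : (3 <= d)%N -> exists xi, `|charfun d s| <=
  `|fourier R p (fun a => expi (s (ord_of_Fp a) 0)) xi| / p%:R.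
Proof.
move=> d3; have p0 : 0 < p%:R :> R[i] by rewrite ltr0n prime_gt0.
have [|xi] := @ex_large_fourier R p p_pr d (fun a => expi (s (ord_of_Fp a) 0)) d3.
  by move=> a; rewrite norm_expi.
move=> h; exists xi; rewrite norm_charfun.
have N := card_zero_sum R p p_pr d (ltn_trans (ltn0Sn 1) d3).
have N0 : 0 < #|[pred x : 'rV['F_p]_d | \sum_i x 0 i == 0]|%:R :> R[i].
  by rewrite -(pmulr_rgt0 _ p0) N exprn_gt0.
have dE : p%:R ^+ d = p%:R ^+ d.-1 * p%:R :> R[i].
  by rewrite -exprSr prednK // ltnW // ltnW.
rewrite ler_pdivrMr // mulrAC ler_pdivlMr // -(ler_pM2l p0) [leRHS]mulrCA N dE.
by rewrite !mulrA ler_pM2r // [leRHS]mulrC.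
Qed.

Lemma charfun_cos d s (c : R) : (3 <= d)%N -> c%:C <= `|charfun d s| ->
  exists (j : 'I_p) (theta : R),
    c * p%:R <= \sum_(i < p) cos (s i 0 - 2 * pi * (j%:R / p%:R) * i%:R - theta).
Proof.
move=> d3 hc; have p0 : 0 < p%:R :> R by rewrite ltr0n prime_gt0.
have [xi /(le_trans hc)] := charfun_le_fourier d s d3.
set F := fourier _ _ _ _; rewrite ler_pdivlMr ?ltr0n ?prime_gt0 // => hF.
have [theta Ft] := polar R F.
exists (ord_of_Fp xi), theta.
have normF : `|F| = \sum_a expi (s (ord_of_Fp a) 0
    - 2 * pi * (xi%:R / p%:R) * a%:R - theta).
  (* Rotating by the argument of [F] makes the sum equal to its modulus, so taking real parts below
     loses nothing. *)
  transitivity (F * expi (- theta)).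
    by rewrite [in RHS]Ft -mulrA -expiD subrr expi0 mulr1.
  rewrite /F /fourier mulr_suml; apply: eq_bigr => a _.
  by rewrite chiN // chiM // -expiN -!expiD.
have {hF} : c * p%:R <= complex.Re `|F|.
  have : (c * p%:R)%:C <= `|F| by rewrite rmorphM /= rmorph_nat.
  by rewrite lecE => /andP[].
rewrite normF raddf_sum /= (reindex ord_of_Fp) //=.
by exists (cast_ord (esym (Fp_cast p_pr))) => a _; rewrite /ord_of_Fp (cast_ordK, cast_ordKV).
Qed.

End CharacteristicFunction.

(** * Placing s in a tube *)

Theorem theorem3p3 (R : realType) (d : nat) (hd : (3 <= d)%N) :
  exists2 alpha0 : R, 0 < alpha0 &
  forall alpha : R, 0 < alpha -> alpha < alpha0 ->
  exists (A : R) (p0 : nat), forall p : nat, prime p -> (p0 <= p)%N ->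
  forall O : 'M[R]_(p, p.-1), orthogonalQ O ->
  forall s : 'cV[R]_p,
    (1 - alpha / p%:R ^+ 2)%:C <= `| charfun d s | ->
  exists (j : 'I_p) (kappa : R),
    [/\ 0 < kappa, kappa <= A / p%:R & in_mod_2piZ s (Bset O j kappa)].
Proof.
(* The 8 in A = 8 alpha is the one in t^2 / 8 <= 1 - cos t. *)
exists 1 => // alpha alpha_gt0 _; exists (8 * alpha), 0%N => p p_pr _ O O_orth s hs.
have pi0 := pi_gt0 R; have p0 : 0 < p%:R :> R by rewrite ltr0n prime_gt0.
have [j [theta]] := charfun_cos R p p_pr d s _ hd hs.
pose u i := s i 0 - 2 * pi * (j%:R / p%:R) * i%:R - theta.
have -> : (1 - alpha / p%:R ^+ 2) * p%:R = p%:R - alpha / p%:R.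
  by field; rewrite gt_eqF.
rewrite (eq_bigr (fun i => cos (u i))) // => hcos.
have [n hn] := fin_all_exists (fun i : 'I_p => mod2pi R (u i)).
pose v : 'cV[R]_p := \col_i (u i - 2 * pi * (n i)%:~R).
have hv : \sum_i v i 0 ^+ 2 <= 8 * alpha / p%:R.
  have : \sum_(i < p) v i 0 ^+ 2 / 8 <= \sum_(i < p) (1 - cos (u i)).
    apply: ler_sum => i _; rewrite mxE.
    have -> : cos (u i) = cos (u i - 2 * pi * (n i)%:~R).
      by rewrite -mulrN -mulrNz cos_add2piz.
    exact: one_sub_cos_ge.
  by rewrite sumrB sumr_const card_ord -mulr_suml => h; lra.
exists j, (8 * alpha / p%:R); split => //; first by rewrite divr_gt0 // mulr_gt0.
(* The coordinate along 1 / sqrt p is sqrt p times [a]; removing [m] full turns from [a] brings it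
   into [0, 2 sqrt p pi]. *)
set a := theta + (\sum_i v i 0) / p%:R.
pose m := Num.floor (a / (2 * pi)).
(* The shift - [n i] reduces the phase of coordinate [i]; - [m] is common to all coordinates. *)
exists (\col_i (- n i - m)).
have [x hx decomp] := Qmx_decomp R p O (prime_gt0 p_pr) O_orth (theta - 2 * pi * m%:~R) v.
exists x; first exact: le_trans hx hv.
exists (Num.sqrt p%:R * (theta - 2 * pi * m%:~R + (\sum_i v i 0) / p%:R)); last first.
  rewrite -decomp; apply/matrixP => i l; rewrite !ord1 !mxE.
  by rewrite intrB mulrNz /u; field; rewrite gt_eqF.
have m1 : m%:~R * (2 * pi) <= a.
  by rewrite -ler_pdivlMr ?floor_le // mulr_gt0.
have m2 : a < (m + 1)%:~R * (2 * pi).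
  by rewrite -ltr_pdivrMr ?floorD1_gt // mulr_gt0.
have r0 : 0 < Num.sqrt p%:R :> R by rewrite sqrtr_gt0.
rewrite intrD in m2; rewrite /= in_itv /= addrAC -/a; set r := Num.sqrt _ in r0 *; apply/andP; split.
  by rewrite mulr_ge0 ?(ltW r0) //; lra.
by rewrite [2 * r]mulrC -[leRHS]mulrA ler_pM2l //; lra.
Qed.
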